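(* Fix $\xi,\eta_1,\eta_2\in(0,1)$, $\rho>0$, $T>0$, $\lambda>0$, a function $q$ on $[0,T]$ and a continuous function $a:[0,1]^2\to\mathbb R$ with $a(x,y)\ne0$ for $(x,y)\in(0,1)^2$. Let $A_{\widetilde{\mathbf N}}$ and $P_{\widetilde{\mathbf N}}$ be the $(m+1)n_1n_2\times(m+1)n_1n_2$ matrices defined in the context, with $P_{\widetilde{\mathbf N}}$ invertible, and let $m,n_1,n_2\to\infty$. Then $$\{P_{\widetilde{\mathbf N}}^{-1}A_{\widetilde{\mathbf N}}\}_{\widetilde{\mathbf N}}\sim_{\mathrm{GLT}}1\qquad\text{and}\qquad\{P_{\widetilde{\mathbf N}}^{-1}A_{\widetilde{\mathbf N}}\}_{\widetilde{\mathbf N}}\sim_{\sigma}1 .$$ Moreover, $$\{P_{\widetilde{\mathbf N}}^{-1}A_{\widetilde{\mathbf N}}\}_{\widetilde{\mathbf N}}\sim_{\lambda}1 .$$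
   Context: **Parameters.** $m,n_1,n_2$ are positive integers depending on an index $k\in\mathbb N$, all tending to infinity as $k\to\infty$ (with matrix sizes tending monotonically to infinity); sequences and limits are with respect to $k$. No relation between the growth rates of $m,n_1,n_2$ is assumed. $\Delta t=T/m$, $\alpha_m=(\Delta t)^{\xi}\Gamma(2-\xi)$, $\beta_{n_\ell}=\big(\tfrac1{n_\ell+1}\big)^{\eta_\ell}\Gamma(2-\eta_\ell)$ for $\ell=1,2$. $x_i=i/(n_1+1)$, $y_j=j/(n_2+1)$, $t_s=s\Delta t$. **Coefficients.** For $k\ge1$ and $\zeta\in(0,1)$ put $w_0^{(\zeta)}=1$, $w_k^{(\zeta)}=(k+1)^{1-\zeta}-2k^{1-\zeta}+(k-1)^{1-\zeta}$, and set $\gamma_k=w_k^{(\xi)}$, $\delta_k=w_k^{(\eta_1)}$, $\sigma_k=w_k^{(\eta_2)}$ for $k\ge0$. $B^x_{n_1}$, $B^y_{n_2}$, $U_m$ are the lower triangular Toeplitz matrices of sizes $n_1,n_2,m$ whose $(i,j)$ entries for $i\ge j$ are $\delta_{i-j}$, $\sigma_{i-j}$, $\gamma_{i-j}e^{-\rho(i-j)\Delta t}$ respectively (and $0$ for $i<j$). **The matrices.** Write $M=n_1n_2$. Spatial indices correspond to grid points $(x_i,y_j)$, $1\le i\le n_1$, $1\le j\le n_2$, with $i$ varying fastest. $D_{\mathbf n}(a)$ is the $M\times M$ diagonal matrix with entries $a(x_i,y_j)$ in this order, and $$G_{\mathbf n}=D_{\mathbf n}(a)\Big(\tfrac{\alpha_m}{\beta_{n_1}}\,I_{n_2}\otimes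 B^x_{n_1}+\tfrac{\alpha_m}{\beta_{n_2}}\,B^y_{n_2}\otimes I_{n_1}\Big).$$ With $\mathbf e_m=(0,\dots,0,1)^T\in\mathbb R^m$, $\mathbf q=(q(t_1),\dots,q(t_m))^T\in\mathbb R^m$ and $\mathrm O$ the $mM\times M$ zero block, $$A_{\widetilde{\mathbf N}}=\begin{bmatrix}U_m\otimes I_M+I_m\otimes G_{\mathbf n}&-\alpha_m\,\mathbf q\otimes I_M\\ \mathbf e_m^T\otimes I_M&\frac{\lambda}{\alpha_m}G_{\mathbf n}\end{bmatrix},\qquad P_{\widetilde{\mathbf N}}=\begin{bmatrix}U_m\otimes I_M+I_m\otimes G_{\mathbf n}&\mathrm O\\ \mathbf e_m^T\otimes I_M&\frac{\lambda}{\alpha_m}G_{\mathbf n}\end{bmatrix},$$ both of size $\widetilde{\mathbf N}=(m+1)n_1n_2$. **Distributions.** Let $\{A_k\}$ be a sequence of square matrices of sizes $d_k\to\infty$ and $\psi:D\subset\mathbb R^t\to\mathbb C$ measurable with $0<\mu_t(D)<\infty$ ($\mu_t$ Lebesgue measure). $\{A_k\}\sim_\sigma\psi$ means $\frac1{d_k}\sum_{i=1}^{d_k}F(\sigma_i(A_k))\to\frac1{\mu_t(D)}\int_DF(|\psi(\mathbf x)|)\,d\mathbf x$ for all continuous compactly supported $F:\mathbb R\to\mathbb C$, where $\sigma_i$ are the singular values. $\{A_k\}\sim_\lambda\psi$ means $\frac1{d_k}\sum_{i=1}^{d_k}F(\lambda_i(A_k))\to\frac1{\mu_t(D)}\int_DF(\psi(\mathbf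 x))\,d\mathbf x$ for all continuous compactly supported $F:\mathbb C\to\mathbb C$, where $\lambda_i$ are the eigenvalues with multiplicity. For $\psi\equiv1$ the right-hand sides equal $F(1)$. **GLT sequences (standard definition, scalar $d$-level case).** Let $\mathbf N=\mathbf N(k)\in\mathbb N^d$ with all components tending to infinity, $\nu(\mathbf N)=\prod_rN_r$, and index matrices of size $\nu(\mathbf N)$ by multi-indices $\mathbf 1\le\mathbf i\le\mathbf N$ in lexicographic order (last component fastest). For $f\in L^1([-\pi,\pi]^d)$ with Fourier coefficients $\hat f_{\mathbf k}=(2\pi)^{-d}\int f(\theta)e^{-\mathrm i\mathbf k\cdot\theta}d\theta$ put $T_{\mathbf N}(f)=[\hat f_{\mathbf i-\mathbf j}]_{\mathbf i,\mathbf j=\mathbf 1}^{\mathbf N}$; for $b:[0,1]^d\to\mathbb C$ let $\mathrm{diag}_{\mathbf N}(b)$ be the diagonal matrix with entries $b(i_1/N_1,\dots,i_d/N_d)$. For a measurable $\kappa:[0,1]^d\times[-\pi,\pi]^d\to\mathbb C$, $\{A_k\}\sim_{\mathrm{GLT}}\kappa$ means: for each $p\in\mathbb N$ there are finitely many $b_{j,p}\in C^\infty([0,1]^d)$ and trigonometric polynomials $f_{j,p}$ in $d$ variables such that $\sum_jb_{j,p}(\mathbf x)f_{j,p}(\theta)\to\kappa(\mathbf x,\theta)$ in measure as $p\to\infty$, and, with $B_{k,p}=\sum_j\mathrm{diag}_{\mathbf N}(b_{j,p})T_{\mathbf N}(f_{j,p})$, there are $c(p),\omega(p)\to0$ and $k_p$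 such that for all $k\ge k_p$ one can write $A_k=B_{k,p}+R_{k,p}+E_{k,p}$ with $\operatorname{rank}R_{k,p}\le c(p)\nu(\mathbf N)$ and spectral norm $\|E_{k,p}\|\le\omega(p)$. Here $d=3$ and $\mathbf N=(m+1,n_2,n_1)$ (time level, $y$ level, $x$ level), and the symbol is the constant function $1$. *)

(* Defs.v *)
From HB Require Import structures.
From mathcomp Require Import all_boot all_order all_algebra.
From mathcomp Require Import all_classical all_reals all_analysis.
From mathcomp Require Import complex mxtens.

Set Implicit Arguments.
Unset Strict Implicit.
Unset Printing Implicit Defensive.

Import Order.TTheory GRing.Theory Num.Theory numFieldNormedType.Exports.

Local Open Scope classical_set_scope.
Local Open Scope ring_scope.
Local Open Scope complex_scope.

(* Lebesgue measure on R^n, realised on n.-tuple R with its product (Borel)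
   sigma-algebra: the image of the product of n copies of lebesgue_measure. *)
Lemma sigma_finite_product d1 d2 (T1 : measurableType d1)
    (T2 : measurableType d2) (R : realType)
    (m1 : {sigma_finite_measure set T1 -> \bar R})
    (m2 : {sigma_finite_measure set T2 -> \bar R}) :
  sigma_finite setT (m1 \x m2)%E.
Proof.
have /sigma_finiteP[F [TF ndF Foo]] := sigma_finiteT m1.
have /sigma_finiteP[G [TG ndG Goo]] := sigma_finiteT m2.
exists (fun n => F n `*` G n).
  rewrite -setXTT TF TG predeqE => -[x y]; split.
    move=> [/= [n _ Fnx] [k _ Gky]]; exists (maxn n k) => //; split.
    - by move: x Fnx; exact/subsetPset/ndF/leq_maxl.
    - by move: y Gky; exact/subsetPset/ndG/leq_maxr.
  by move=> [n _ []/= ? ?]; split; exists n.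
move=> k; have [? ?] := Foo k; have [? ?] := Goo k.
split; first exact: measurableX.
by rewrite product_measure1E// lte_mul_pinfty// ge0_fin_numE.
Qed.

Section tuple_lebesgue.
Context {R : realType}.

Definition tcons n (p : measurableTypeR R * n.-tuple (measurableTypeR R)) :
  n.+1.-tuple (measurableTypeR R) := [tuple of p.1 :: p.2].

Lemma measurable_tcons n : measurable_fun [set: _] (@tcons n).
Proof. exact: measurable_cons. Qed.

Definition tuncons n (t : n.+1.-tuple (measurableTypeR R)) :
  measurableTypeR R * n.-tuple (measurableTypeR R) :=
  (thead t, [tuple of behead t]).

Lemma tunconsK n : cancel (@tuncons n) (@tcons n).
Proof. by move=> t; apply: val_inj => /=; rewrite [in RHS](tuple_eta t). Qed.

Lemma tconsK n : cancel (@tcons n) (@tuncons n).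
Proof. by move=> [x t]; congr pair; apply: val_inj. Qed.

Lemma measurable_tuncons n : measurable_fun [set: _] (@tuncons n).
Proof.
apply/measurable_fun_pairP; split; first exact: measurable_tnth.
exact: measurable_behead.
Qed.

Section step.
Variables (n : nat)
  (mu : {sigma_finite_measure set (n.-tuple (measurableTypeR R)) -> \bar R}).

Definition lebesgue_cons := pushforward (lebesgue_measure \x mu)%E (@tcons n).

Let lebesgue_cons0 : lebesgue_cons set0 = 0%E.
Proof. by rewrite /lebesgue_cons /pushforward preimage_set0 measure0. Qed.

Let lebesgue_cons_ge0 A : (0 <= lebesgue_cons A)%E.
Proof. by rewrite /lebesgue_cons /pushforward; apply: measure_ge0. Qed.

Let lebesgue_cons_sigma_additive : semi_sigma_additive lebesgue_cons.
Proof.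
have mpre A : measurable A -> measurable (@tcons n @^-1` A).
  by move=> mA; rewrite -[X in measurable X]setTI; exact: measurable_tcons.
move=> F mF tF mUF; rewrite /lebesgue_cons /pushforward preimage_bigcup.
apply: measure_semi_sigma_additive => [i||]; first exact: mpre.
- apply/trivIsetP => /= i j _ _ ij; rewrite -preimage_setI.
  by move/trivIsetP : tF => /(_ _ _ _ _ ij) ->//; rewrite preimage_set0.
- by rewrite -preimage_bigcup; exact: mpre.
Qed.

HB.instance Definition _ := isMeasure.Build _ _ _ lebesgue_cons
  lebesgue_cons0 lebesgue_cons_ge0 lebesgue_cons_sigma_additive.

Let lebesgue_cons_sigma_finite : sigma_finite setT lebesgue_cons.
Proof.
have [F FT mF] := sigma_finite_product lebesgue_measure mu.
exists (fun i => @tuncons n @^-1` F i).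
  by rewrite -preimage_bigcup -FT preimage_setT.
move=> i; have [mFi Fioo] := mF i; split.
  by rewrite -[X in measurable X]setTI; exact: measurable_tuncons.
rewrite /lebesgue_cons /pushforward -comp_preimage.
by rewrite (_ : _ \o _ = id) //; apply/funext => p; exact: tconsK.
Qed.

HB.instance Definition _ :=
  Measure_isSigmaFinite.Build _ _ _ lebesgue_cons lebesgue_cons_sigma_finite.

End step.

Fixpoint lebesgue_tuple n :
    {sigma_finite_measure set (n.-tuple (measurableTypeR R)) -> \bar R} :=
  if n is n'.+1 then lebesgue_cons (lebesgue_tuple n') else \d_ [tuple].

End tuple_lebesgue.

Lemma lebesgue_tuple_box (R : realType) n (A : 'I_n -> set (measurableTypeR R)) :
  (forall i, measurable (A i)) ->
  lebesgue_tuple n [set t : n.-tuple (measurableTypeR R) | forall i, A i (tnth t i)] =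
  (\prod_(i < n) lebesgue_measure (A i))%E.
Proof.
elim: n A => [|n IHn] A mA.
  by rewrite big_ord0 /= diracE mem_set// => -[].
pose B := [set t : n.-tuple (measurableTypeR R) | forall i, A (lift ord0 i) (tnth t i)].
have mB : measurable B.
  rewrite (_ : B = \bigcap_(i in [set: 'I_n]) 
      ((@tnth n (measurableTypeR R))^~ i @^-1` A (lift ord0 i))).
    apply: fin_bigcap_measurable => [|i _]; first exact: finite_finset.
    by rewrite -[X in measurable X]setTI; exact: measurable_tnth.
  by apply/seteqP; split => [t Bt i _|t Bt i]; exact: Bt.
rewrite /= /lebesgue_cons /pushforward (_ : _ @^-1` _ = A ord0 `*` B).
  rewrite product_measure1E// big_ord_recl; congr (_ * _)%E.
  by apply: (IHn (fun i => A (lift ord0 i))) => i; exact: mA.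
apply/seteqP; split => [[x t] /= h|[x t] /= [h1 h2] i].
  split=> [|i]; first by have := h ord0.
  by have := h (lift ord0 i); rewrite tnthS.
by case: (unliftP ord0 i) => [j|] ->; rewrite ?tnthS.
Qed.

Section analysis.
Context {R : realType}.
Local Notation C := R[i].

Definition row_of_tuple n (t : n.-tuple (measurableTypeR R)) : 'rV[R]_n := \row_i tnth t i.

Definition cmodulus (z : C) : R := complex.Re `|z|.

Definition expi (t : R) : C := cos t +i* sin t.

(* C is identified with R^2 for measurability and integration *)
Definition cmeasurable n (D : set (n.-tuple (measurableTypeR R))) (f : n.-tuple (measurableTypeR R) -> C) :=
  measurable_fun D (fun x => complex.Re (f x)) /\
  measurable_fun D (fun x => complex.Im (f x)).

Definition cintegral n (D : set (n.-tuple (measurableTypeR R))) (f : n.-tuple (measurableTypeR R) -> C) : C :=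
  Rintegral (lebesgue_tuple n) D (fun x => complex.Re (f x)) +i*
  Rintegral (lebesgue_tuple n) D (fun x => complex.Im (f x)).

(* \int_0^{+oo} t^(z - 1) e^(-t) dt *)
Definition Gamma (z : R) : R :=
  Rintegral lebesgue_measure `]0, +oo[ (fun t => t `^ (z - 1) * expR (- t)).

Definition adjoint n (A : 'M[C]_n) : 'M[C]_n := (map_mx Num.conj A)^T.

(* The roots of the characteristic polynomial, listed with multiplicity. *)
Definition eigenvalues n (A : 'M[C]_n) : seq C :=
  sval (closed_field_poly_normal (char_poly A)).

Definition singular_values n (A : 'M[C]_n) : seq R :=
  [seq Num.sqrt (complex.Re z) | z <- eigenvalues (adjoint A *m A)].

Definition spectral_norm n (A : 'M[C]_n) : R :=
  \big[Num.max/0]_(s <- singular_values A) s.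

Section distributions.
Variables (d : nat -> nat) (A : forall k, 'M[C]_(d k)).
Variables (t : nat) (D : set (t.-tuple (measurableTypeR R))).
Variable psi : t.-tuple (measurableTypeR R) -> C.

(* standing assumptions on the sizes and on the symbol psi : D -> C *)
Definition admissible_symbol : Prop :=
  [/\ d @ \oo --> \oo, measurable D,
      (0 < lebesgue_tuple t D < +oo)%E & cmeasurable D psi].

Definition mean_value (g : t.-tuple (measurableTypeR R) -> C) : C :=
  ((fine (lebesgue_tuple t D))^-1)%:C * cintegral D g.

Definition sv_distributed : Prop := admissible_symbol /\
  forall F : R -> C^o, continuous F -> compact (closure [set s | F s != 0]) ->
  (fun k => (d k)%:R^-1 * \sum_(s <- singular_values (A k)) F s : C^o) @ \oo
    --> (mean_value (fun x => F (cmodulus (psi x))) : C^o).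

Definition ev_distributed : Prop := admissible_symbol /\
  forall F : C^o -> C^o, continuous F -> compact (closure [set z | F z != 0]) ->
  (fun k => (d k)%:R^-1 * \sum_(z <- eigenvalues (A k)) F z : C^o) @ \oo
    --> (mean_value (fun x => F (psi x)) : C^o).

End distributions.

Section glt.
Variable d : nat.

Definition nu (N : d.-tuple nat) : nat := \prod_(r < d) tnth N r.

(* The r-th component, counted from 0, of the l-th multi-index in the
   lexicographic order where the last component varies fastest. *)
Definition multi_index (N : d.-tuple nat) (l : 'I_(nu N)) (r : 'I_d) : nat :=
  (l %/ \prod_(s < d | (r < s)%N) tnth N s) %% tnth N r.

Definition frequency (k : 'rV[int]_d) (theta : 'rV[R]_d) : R :=
  \sum_(r < d) (k 0 r)%:~R * theta 0 r.

Definition trig_polynomial (f : 'rV[R]_d -> C) : Prop :=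
  exists s : seq ('rV[int]_d * C),
    f = fun theta => \sum_(kc <- s) kc.2 * expi (frequency kc.1 theta).

Definition fourier_coef (f : 'rV[R]_d -> C) (k : 'rV[int]_d) : C :=
  (((2 * pi) ^+ d)^-1)%:C *
  cintegral [set t : d.-tuple (measurableTypeR R) | forall r, - pi <= row_of_tuple t 0 r <= pi]
    (fun t => f (row_of_tuple t) * expi (- frequency k (row_of_tuple t))).

Definition toeplitz (N : d.-tuple nat) (f : 'rV[R]_d -> C) : 'M[C]_(nu N) :=
  \matrix_(l, l') fourier_coef f
    (\row_r ((multi_index l r)%:Z - (multi_index l' r)%:Z)).

Definition diag_sampling (N : d.-tuple nat) (b : 'rV[R]_d -> C) : 'M[C]_(nu N) :=
  diag_mx (\row_l b (\row_r ((multi_index l r).+1%:R / (tnth N r)%:R))).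

Definition partial (i : 'I_d) (f : 'rV[R]_d -> R) : 'rV[R]_d -> R :=
  fun x => 'D_(delta_mx 0 i) f x.

Definition smooth (f : 'rV[R]_d -> R) : Prop :=
  forall s : seq 'I_d, let g := foldr partial f s in
    continuous g /\ forall (i : 'I_d) x, derivable g x (delta_mx 0 i).

(* Elements of C^oo([0,1]^d) are represented by smooth extensions to R^d. *)
Definition csmooth (b : 'rV[R]_d -> C) : Prop :=
  smooth (fun x => complex.Re (b x)) /\ smooth (fun x => complex.Im (b x)).

(* Points of [0,1]^d x [-pi,pi]^d are (d + d)-tuples (x, theta). *)
Definition xpart (z : (d + d).-tuple (measurableTypeR R)) : 'rV[R]_d :=
  lsubmx (row_of_tuple z).

Definition thetapart (z : (d + d).-tuple (measurableTypeR R)) : 'rV[R]_d :=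
  rsubmx (row_of_tuple z).

Definition symbol_domain : set ((d + d).-tuple (measurableTypeR R)) :=
  [set z | forall r, 0 <= xpart z 0 r <= 1 /\ - pi <= thetapart z 0 r <= pi].

Definition on_symbol_domain (kappa : 'rV[R]_d -> 'rV[R]_d -> C) :
  (d + d).-tuple (measurableTypeR R) -> C := fun z => kappa (xpart z) (thetapart z).

Definition cvg_in_measure (g : nat -> 'rV[R]_d -> 'rV[R]_d -> C)
    (kappa : 'rV[R]_d -> 'rV[R]_d -> C) : Prop :=
  forall e : R, 0 < e ->
  (fun p => lebesgue_tuple (d + d)
     (symbol_domain `&` [set z | e <= cmodulus
        (on_symbol_domain (g p) z - on_symbol_domain kappa z)])) @ \oo --> 0%E.

Definition GLT (N : nat -> d.-tuple nat) (A : forall k, 'M[C]_(nu (N k)))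
    (kappa : 'rV[R]_d -> 'rV[R]_d -> C) : Prop :=
  [/\ forall r : 'I_d, (fun k => tnth (N k) r) @ \oo --> \oo,
      cmeasurable symbol_domain (on_symbol_domain kappa) &
  exists (J : nat -> nat)
    (b : forall p, 'I_(J p) -> 'rV[R]_d -> C)
    (f : forall p, 'I_(J p) -> 'rV[R]_d -> C),
  [/\ forall p j, csmooth (b p j) /\ trig_polynomial (f p j),
      cvg_in_measure (fun p x theta => \sum_(j < J p) b p j x * f p j theta)
        kappa &
      exists (c omega : nat -> R) (k0 : nat -> nat),
      [/\ c @ \oo --> 0, omega @ \oo --> 0 &
      forall p k, (k0 p <= k)%N -> exists Rkp Ekp : 'M[C]_(nu (N k)),
        [/\ A k = \sum_(j < J p)
                    diag_sampling (N k) (b p j) *m toeplitz (N k) (f p j)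
                  + Rkp + Ekp,
            (\rank Rkp)%:R <= c p * (nu (N k))%:R &
            spectral_norm Ekp <= omega p]]]].

End glt.
End analysis.

Arguments symbol_domain {R} d.
Arguments GLT {R d} N A kappa.

Section matrices.
Context {R : realType}.
Variables (xi eta1 eta2 rho T lambda : R) (q : R -> R) (a : R * R -> R).

Definition wcoef (zeta : R) (k : nat) : R :=
  if k is k'.+1 then
    k.+1%:R `^ (1 - zeta) - 2 * k%:R `^ (1 - zeta) + k'%:R `^ (1 - zeta)
  else 1.

Section sizes.
Variables (m n1 n2 : nat).

Definition dt : R := T / m%:R.

Definition alpha : R := dt `^ xi * Gamma (2 - xi).

Definition beta (n : nat) (eta : R) : R := (n.+1%:R)^-1 `^ eta * Gamma (2 - eta).

Definition lower_toeplitz n (c : nat -> R) : 'M[R]_n :=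
  \matrix_(i, j) if (j <= i)%N then c (i - j)%N else 0.

Definition Bmx (zeta : R) n : 'M[R]_n := lower_toeplitz n (wcoef zeta).

Definition Umx : 'M[R]_m :=
  lower_toeplitz m (fun l => wcoef xi l * expR (- rho * l%:R * dt)).

(* Rows of n2 * n1 matrices are numbered as in the Kronecker product *t : the
   index pair is (j, i), where i, the number of x_i, varies fastest. *)
Definition Dmx : 'M[R]_(n2 * n1) :=
  diag_mx (\row_l a ((mxtens_unindex l).2.+1%:R / n1.+1%:R,
                     (mxtens_unindex l).1.+1%:R / n2.+1%:R)).

Definition Gmx : 'M[R]_(n2 * n1) :=
  Dmx *m ((alpha / beta n1 eta1) *: ((1%:M : 'M[R]_n2) *t Bmx eta1 n1)
          + (alpha / beta n2 eta2) *: (Bmx eta2 n2 *t (1%:M : 'M[R]_n1))).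

Definition evec : 'cV[R]_m := \col_(s < m) (s.+1 == m)%:R.

Definition qvec : 'cV[R]_m := \col_(s < m) q (s.+1%:R * dt).

Let M := (n2 * n1)%N.

Definition time_block : 'M[R]_(m * M) :=
  Umx *t (1%:M : 'M[R]_M) + (1%:M : 'M[R]_m) *t Gmx.

(* The last block row and column have size 1 * M, hence G = I_1 (x) G. *)
Definition last_block : 'M[R]_(1 * M) :=
  (lambda / alpha) *: ((1%:M : 'M[R]_1) *t Gmx).

Definition levels : 3.-tuple nat := [tuple m.+1; n2; n1].

Lemma size_levels : (m * M + 1 * M)%N = nu levels.
Proof.
by rewrite /nu !big_ord_recl big_ord0 -mulnDl addn1 /= !tnthS /= muln1.
Qed.

Definition Amx : 'M[R]_(nu levels) := castmx (size_levels, size_levels)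
  (block_mx time_block (- alpha *: (qvec *t (1%:M : 'M[R]_M)))
            (evec^T *t (1%:M : 'M[R]_M)) last_block).

Definition Pmx : 'M[R]_(nu levels) := castmx (size_levels, size_levels)
  (block_mx time_block 0 (evec^T *t (1%:M : 'M[R]_M)) last_block).

Definition preconditioned : 'M[R[i]]_(nu levels) :=
  map_mx (real_complex R) (invmx Pmx *m Amx).

End sizes.
End matrices.

(* Main.v *)
Require Import Defs.
From HB Require Import structures.
From mathcomp Require Import all_boot all_order all_algebra.
From mathcomp Require Import all_classical all_reals all_analysis.
From mathcomp Require Import complex mxtens.
From mathcomp Require Import measurable_realfun zify ring lra.

Set Implicit Arguments.
Unset Strict Implicit.
Unset Printing Implicit Defensive.

Import Order.TTheory GRing.Theory Num.Theory numFieldNormedType.Exports.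

Local Open Scope classical_set_scope.
Local Open Scope ring_scope.

(** The matrices A and P differ only in the upper right block, which has
    n1 n2 columns.  Hence X = P^-1 A satisfies X - 1 = P^-1 (A - P), of rank at
    most n1 n2, a fraction 1 / (m + 1) of the size of X
    ([rank_preconditioned_sub1]).  This rank bound yields the three claims.

    Eigenvalues: a matrix with rank (X - c) <= r has at most r eigenvalues other
    than c, counted with multiplicity ([count_eigenvalues_neq]).  So all but a
    vanishing fraction of the eigenvalues of X are 1; the others contribute
    little to the mean of F, because a continuous function of compact support is
    bounded ([cvg_mean_few_outliers]).

    Singular values: X^* X - 1 = X^* (X - 1) + (X - 1)^* has rank at most
    2 n1 n2, so the same argument applies to the eigenvalues of X^* X
    ([count_singular_values_neq1]).

    GLT: X = I + (X - I) + 0 is a decomposition of the required form, in which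
    I = diag(1) T(1) is the approximation and X - I the low rank term.  That
    T(1) = I says that the constant 1 has Fourier coefficients 1 at 0 and 0
    elsewhere ([fourier_coef1]), an integral over a cube which Fubini's theorem
    splits into one-dimensional ones ([integral_cos]), and that the multi-index
    determines the position in the lexicographic order ([multi_index_inj]). *)

(** * Low rank perturbations of scalar matrices *)

Section spectrum.

Context {R : realType}.
Local Notation C := R[i].

Lemma size_eigenvalues n (A : 'M[C]_n) : size (eigenvalues A) = n.
Proof.
rewrite /eigenvalues; case: closed_field_poly_normal => s /= e.
have := size_char_poly A.
by rewrite e (monicP (char_poly_monic A)) scale1r size_prod_XsubC => -[].
Qed.

Lemma count_eigenvalues n (A : 'M[C]_n) (c : C) :
  count_mem c (eigenvalues A) = mup c (char_poly A).
Proof.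
rewrite /eigenvalues; case: closed_field_poly_normal => s /= e.
by rewrite e (monicP (char_poly_monic A)) scale1r mu_prod_XsubC.
Qed.

(** The algebraic multiplicity of c is at least the geometric one.  Gaussian
    elimination conjugates A to c + K with all rows of K zero from row r on; those rows of
    'X - c - K are multiples of 'X - c, so each term of the Leibniz expansion of
    the characteristic polynomial is divisible by ('X - c) ^+ (n - r). *)
Lemma count_eigenvalues_neq n (A : 'M[C]_n) (c : C) :
  (count (predC1 c) (eigenvalues A) <= \rank (A - c%:M)%R)%N.
Proof.
set B := (A - c%:M)%R; set r := \rank B.
pose L := col_ebase B; pose K := (pid_mx r : 'M[C]_n) *m (row_ebase B *m L).
have uL : L \in unitmx by exact: col_ebase_unit.
have BE : A = c%:M + L *m K *m invmx L.
  by rewrite !mulmxA mulmxK // mulmx_ebase /B addrC subrK.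
have LV : map_mx polyC L *m map_mx polyC (invmx L) = 1%:M.
  by rewrite -map_mxM mulmxV // map_mx1.
have charA : char_poly A = \det (('X - c%:P)%:M - map_mx polyC K).
  have -> : char_poly A = \det (map_mx polyC L *m
      (('X - c%:P)%:M - map_mx polyC K) *m map_mx polyC (invmx L)).
    congr (\det _); rewrite /char_poly_mx mulmxBr mulmxBl scalar_mxC.
    rewrite -(mulmxA _%:M) LV.
    rewrite mulmx1 -!map_mxM [in LHS]BE map_mxD map_scalar_mx.
    by rewrite opprD addrA raddfB.
  by rewrite !det_mulmx mulrAC -det_mulmx LV det1 mul1r.
have dvd : ('X - c%:P) ^+ (n - r) %| char_poly A.
  rewrite charA.
  apply: (big_ind (fun p => _ %| p)) => [||s _].
  - exact: dvdp0.
  - exact: dvdp_add.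
  apply: dvdp_mull; rewrite -prodr_const_nat big_geq_mkord /= big_mkcond /=.
  apply: (big_rec2 (fun p p' => p %| p')) => [|i p p' _]; first exact: dvdpp.
  apply: dvdp_mul; case: leqP => [ri|_]; last exact: dvd1p.
  have Ki0 j : K i j = 0.
    by rewrite mxE big1 // => l _; rewrite mxE ltnNge ri andbF mul0r.
  (* K is made opaque, so that [mxE] does not unfold its product. *)
  move: Ki0; generalize K => K0 K0i0.
  by rewrite !mxE K0i0 subr0; case: eqP => _; rewrite ?mulr1n ?dvdpp ?dvdp0.
have := count_predC (pred1 c) (eigenvalues A).
rewrite size_eigenvalues count_eigenvalues => cE.
have : (n - r <= mup c (char_poly A))%N.
  by rewrite mup_geq // monic_neq0 // char_poly_monic.
have := rank_leq_row B : (r <= n)%N.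
rewrite (eq_count (_ : _ =1 predC (pred1 c))) //; lia.
Qed.

Lemma spectral_norm0 n : spectral_norm (0 : 'M[C]_n) = 0.
Proof.
rewrite /spectral_norm big_seq; apply: big1_idem => [|s]; first exact: maxxx.
rewrite /singular_values => /mapP[z zs ->].
suff -> : z = 0 by rewrite sqrtr0.
apply/eqP/negPn/negP => z0; move: zs.
have := count_eigenvalues_neq (adjoint (0 : 'M[C]_n) *m 0) 0.
rewrite mulmx0 raddf0 subrr mxrank0 leqn0 -[_ == _]negbK -lt0n -has_count.
by move=> /hasPn h /h /=; rewrite z0.
Qed.

Lemma size_singular_values n (A : 'M[C]_n) : size (singular_values A) = n.
Proof. by rewrite size_map size_eigenvalues. Qed.

(** With B = A - 1, one has A^* A - 1 = A^* B + B^*, and adjunction preserves the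
    rank. *)
Lemma rank_adjoint_mul_sub1 n (A : 'M[C]_n) :
  (\rank (adjoint A *m A - 1%:M)%R <= \rank (A - 1%:M)%R + \rank (A - 1%:M)%R)%N.
Proof.
set B := (A - 1%:M)%R.
have -> : adjoint A *m A - 1%:M = adjoint A *m B + adjoint B.
  rewrite /B /adjoint mulmxBr mulmx1 map_mxD linearD map_mxN linearN /=.
  by rewrite map_mx1 trmx1 addrA subrK.
apply: leq_trans (mxrank_add _ _) _; apply: leq_add.
  by apply/mxrankS/submxMl.
by rewrite /adjoint mxrank_tr mxrank_map.
Qed.

Lemma count_singular_values_neq1 n (A : 'M[C]_n) :
  (count (predC1 1%R) (singular_values A) <=
     \rank (A - 1%:M)%R + \rank (A - 1%:M)%R)%N.
Proof.
apply: leq_trans (rank_adjoint_mul_sub1 A).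
apply: leq_trans (count_eigenvalues_neq _ _).
rewrite /singular_values count_map; apply: sub_count => z /=.
by apply: contraNN => /eqP ->; rewrite sqrtr1.
Qed.

End spectrum.

(** * Means of bounded functions over almost constant lists *)

Section means.

Context {R : realType}.
Local Notation C := R[i].
Local Open Scope complex_scope.

Lemma continuous_Re : continuous (fun z : C^o => complex.Re z : R).
Proof.
move=> z; have FF : Filter (nbhs z) by exact: nbhs_filter.
apply/cvgrPdist_le => e e0.
have e0' : 0 < e%:C by rewrite ltcR.
exists e%:C => // w /= /ltW h.
rewrite -raddfB -lecR; apply: le_trans h; exact: normc_ge_Re.
Qed.

Lemma norm_cmodulus (z : C) : `|z| = (cmodulus z)%:C.
Proof. by rewrite /cmodulus RRe_real // normr_real. Qed.

(** The modulus of F has a bounded image on its compact support.  It is handled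
    as a real function, so that boundedness of compact sets can be used over a
    real field. *)
Lemma bounded_compact_support (T : topologicalType) (F : T -> C^o) :
  continuous F -> compact (closure [set x | F x != 0]) ->
  exists2 B : R, 0 <= B & forall x, `|F x| <= B%:C.
Proof.
move=> cF cK; pose g x : R := cmodulus (F x).
have cg : continuous g.
  move=> x; apply: (@continuous_comp _ _ _ (fun x => `|F x| : C^o)
    (fun z => complex.Re z)).
    by apply: continuous_comp; [exact: cF|exact: norm_continuous].
  exact: continuous_Re.
have /compact_bounded[M [_ hM]] :=
  continuous_compact (continuous_subspaceT cg) cK.
exists (`|M| + 1) => [|x]; first by rewrite addr_ge0.
rewrite norm_cmodulus lecR.
have [->|Fx0] := eqVneq (F x) 0; first by rewrite /cmodulus normr0 addr_ge0.
have Mlt : M < `|M| + 1 by rewrite (le_lt_trans (ler_norm M)) // ltrDl.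
apply: le_trans (ler_norm _) (hM _ Mlt _ _); exists x => //.
exact: subset_closure.
Qed.

(** A term of the list other than c moves the mean away from F c by at most
    2 B / d; since at most K d / m terms are concerned, the total error is at most
    2 K B / m. *)
Lemma cvg_mean_few_outliers (T : eqType) (d m : nat -> nat)
    (s : forall k, seq T) (F : T -> C^o) (c : T) (B : R) (K : nat) :
  (forall x, `|F x| <= B%:C) -> m @ \oo --> \oo ->
  (forall k, (0 < d k)%N) -> (forall k, size (s k) = d k) ->
  (forall k, (count (predC1 c) (s k) * m k <= K * d k)%N) ->
  (fun k => (d k)%:R^-1 * \sum_(z <- s k) F z : C^o) @ \oo --> (F c : C^o).
Proof.
move=> FB moo d0 sd cs.
have B0 : 0 <= B by rewrite -lecR; apply: le_trans (FB c); exact: normr_ge0.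
(* In C, a positive number is one with zero imaginary part and positive real
   part. *)
apply/cvgrPdist_le; case=> e i0.
rewrite ltcE /= => /andP[/eqP i00 e0]; rewrite {i0}i00.
near=> k.
have dk0 : 0 < (d k)%:R :> C by rewrite ltr0n.
have -> : F c - (d k)%:R^-1 * \sum_(z <- s k) F z
    = (d k)%:R^-1 * \sum_(z <- s k) (F c - F z).
  rewrite sumrB big_const_seq count_predT sd iter_addr addr0 mulrBr.
  by rewrite -(mulr_natl (F c)) mulKf // gt_eqF.
rewrite normrM gtr0_norm ?invr_gt0 // ler_pdivrMl //.
have sumle : `|\sum_(z <- s k) (F c - F z)| <=
    (count (predC1 c) (s k))%:R * (2 * B)%:C.
  apply: le_trans (ler_norm_sum _ _ _) _.
  rewrite (bigID (pred1 c)) /= big1 ?add0r => [|z /eqP ->]; last first.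
    by rewrite subrr normr0.
  apply: (@le_trans _ _ (\sum_(z <- s k | predC1 c z) (2 * B)%:C)).
    apply: ler_sum => z _; apply: le_trans (ler_normB _ _) _.
    have -> : 2 * B = B + B by ring.
    by rewrite rmorphD lerD ?FB.
  by rewrite big_const_seq iter_addr addr0 [leRHS]mulr_natl.
apply: le_trans sumle _.
rewrite -!(rmorph_nat (real_complex R)) -[e +i* 0]/(e%:C) -!rmorphM lecR /=.
have m0 : 0 < (m k)%:R :> R.
  by rewrite ltr0n; near: k; apply: (moo [set j | (0 < j)%N]); exists 1%N.
have mB : K%:R * (2 * B) <= (m k)%:R * e.
  rewrite -ler_pdivrMr //; near: k.
  apply: (moo [set j | K%:R * (2 * B) / e <= j%:R]).
  exists (Num.truncn (K%:R * (2 * B) / e)).+1 => // j /= hj.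
  apply: le_trans (ltW (truncnS_gt _)) _.
  by rewrite ler_nat.
rewrite -(ler_pM2l m0).
have := cs k; rewrite -(ler_nat R) !natrM => h.
have := ler_wpM2r (mulr_ge0 (ler0n R 2) B0) h.
have := ler_wpM2l (ler0n R (d k)) mB.
lra.
Unshelve. all: by end_near.
Qed.

End means.

(** * Trigonometric integrals over cubes *)

Definition cube (R : realType) n (A : set (measurableTypeR R)) :
    set (n.-tuple (measurableTypeR R)) :=
  [set t | forall i, A (tnth t i)].
Arguments cube {R} n A.

Section fourier.

Context {R : realType}.
Local Notation mT := (measurableTypeR R).

Lemma measurable_box n (A : 'I_n -> set mT) : (forall i, measurable (A i)) ->
  measurable [set t : n.-tuple mT | forall i, A i (tnth t i)].
Proof.
move=> mA; rewrite (_ : mkset _ = \bigcap_(i in [set: 'I_n])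
    ((@tnth n mT)^~ i @^-1` A i)).
  apply: fin_bigcap_measurable => [|i _]; first exact: finite_finset.
  by rewrite -[X in measurable X]setTI; exact: measurable_tnth.
by apply/seteqP; split => [t At i _|t At i]; exact: At.
Qed.

Lemma measurable_cube n (A : set mT) : measurable A -> measurable (cube n A).
Proof. by move=> mA; apply: (measurable_box (A := fun=> A)). Qed.

Lemma lebesgue_cube_lty n (A : set mT) : measurable A ->
  (lebesgue_measure A < +oo)%E -> (lebesgue_tuple n (cube n A) < +oo)%E.
Proof.
move=> mA A_fin; rewrite (lebesgue_tuple_box (fun _ => mA)).
elim: n => [|n IH]; first by rewrite big_ord0 ltry.
by rewrite big_ord_recl lte_mul_pinfty // ge0_fin_numE.
Qed.

(** Fubini's theorem, separating the first coordinate; boundedness of f makes it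
    integrable on the cube, which has finite measure. *)
Lemma integral_cubeS n (A : set mT) (M : R) (f : n.+1.-tuple mT -> R) :
  measurable A -> (lebesgue_measure A < +oo)%E ->
  measurable_fun setT f -> (forall t, `|f t| <= M) ->
  (\int[lebesgue_tuple n.+1]_(t in cube n.+1 A) (f t)%:E =
   \int[lebesgue_measure]_(x in A)
     \int[lebesgue_tuple n]_(t in cube n A) (f (tcons (x, t)))%:E)%E.
Proof.
move=> mA A_fin mf fM.
have preE : @tcons R n @^-1` cube n.+1 A = A `*` cube n A.
  apply/seteqP; split => [[x t] /= h|[x t] /= [h1 h2] i].
    split=> [|i]; first by have := h ord0.
    by have := h (lift ord0 i); rewrite tnthS.
  by case: (unliftP ord0 i) => [j|] ->; rewrite ?tnthS.
have mC := @measurable_cube n _ mA.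
have C_fin := @lebesgue_cube_lty n _ mA A_fin.
have mft : measurable_fun setT (f \o @tcons R n).
  by apply: measurableT_comp => //; exact: measurable_tcons.
have int_f : (lebesgue_measure \x lebesgue_tuple n)%E.-integrable
    (A `*` cube n A) (EFin \o (f \o @tcons R n)).
  apply: measurable_bounded_integrable.
  - exact: measurableX.
  - by rewrite /= product_measure1E // lte_mul_pinfty // ge0_fin_numE.
  - exact: measurable_funTS.
  - exists M; split=> [|y My p _ /=]; first exact: num_real.
    exact: le_trans (ltW My).
rewrite /= /lebesgue_cons integral_pushforward //=; first last.
- exact: measurable_cube.
- by rewrite preE.
- exact/measurable_EFinP.
- exact: measurable_tcons.
rewrite preE integral_mkcond -integral12_prod_meas1; last first.
  by rewrite -integrable_mkcond //; exact: measurableX.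
rewrite [RHS]integral_mkcond; apply: eq_integral => x _.
rewrite /fubini_F patchE; case: ifPn => xA.
  rewrite [RHS]integral_mkcond; apply: eq_integral => t _.
  by rewrite !patchE in_setX xA.
by apply: integral0_eq => t _; rewrite patchE in_setX (negbTE xA).
Qed.

Lemma sin_shift_pi (c : R) (k : int) :
  sin (c + k%:~R * pi) = sin (c - k%:~R * pi).
Proof.
have per (x : R) (j : nat) : sin (x + j%:R * pi) = sin (x - j%:R * pi).
  elim: j => [|j IH]; first by rewrite mul0r subr0 addr0.
  rewrite -addn1 natrD mulrDl mul1r addrA sinDpi IH opprD addrA.
  by rewrite -[in LHS](subrK pi (x - _)) sinDpi opprK.
case: k => j; first exact: per.
by rewrite NegzE mulrNz mulNr opprK per.
Qed.

(** For k != 0 the primitive B / k * sin (c + k x) takes the same value at - pi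
    and pi; B stands for the inner integral in the proof of
    [integral_cos]. *)
Lemma integral_cos1 (c B : R) (k : int) :
  (\int[lebesgue_measure]_(x in `[(- pi)%R, pi%R])
     (cos (c + k%:~R * x) * B)%:E =
   (cos c * (2 * pi *+ (k == 0)) * B)%:E)%E.
Proof.
have pi0 := pi_gt0 R.
have piN : - pi < pi :> R by lra.
have [->|k0] := eqVneq k 0.
  under eq_integral do rewrite mul0r addr0.
  rewrite integral_cst //= lebesgue_measure_itv /= lte_fin piN.
  by rewrite -EFinD -EFinM; congr EFin; ring.
have kR : (k%:~R : R) != 0 by rewrite intr_eq0.
pose F x : R := B / k%:~R * sin (c + k%:~R * x).
have dh (x : R) : is_derive x (1 : R) (fun x : R => c + k%:~R * x) k%:~R.
  by apply: is_derive_eq; rewrite /GRing.scale /=; ring.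
have dF (x : R) : is_derive x (1 : R) F (cos (c + k%:~R * x) * B).
  rewrite /F; have := is_derive1_comp (is_derive_sin _) (dh x) => ds.
  by apply: is_derive_eq; rewrite /GRing.scale /=; field.
have cF : continuous F.
  move=> x; apply/differentiable_continuous/derivable1_diffP.
  by have := dF x; case.
rewrite (@continuous_FTC2 _ _ F) //=.
- rewrite -EFinB /F mulrN sin_shift_pi; congr EFin.
  by rewrite mulr0n mulr0 mul0r subrr.
- apply: continuous_subspaceT => x; apply: cvgM; last exact: cvg_cst.
  apply: continuous_comp; last exact: continuous_cos.
  apply/differentiable_continuous/derivable1_diffP.
  by have := dh x; case.
- by split; [move=> x _; have := dF x; case|
    apply: cvg_at_right_filter; exact: cF|apply: cvg_at_left_filter; exact: cF].
- by move=> x _; rewrite derive1E; apply: derive_val.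
Qed.

Lemma measurable_fun_affine n (c : R) (k : 'I_n -> int) :
  measurable_fun setT
    (fun t : n.-tuple mT => c + \sum_(r < n) (k r)%:~R * tnth t r : R).
Proof.
apply: measurable_funD => //; apply: measurable_sum => r.
by apply: measurable_funM => //; exact: measurable_tnth.
Qed.

(** Induction on n: integrating the coordinates after the first leaves a cosine of
    the first one.  The phase c lets the induction go through, and c = - pi / 2
    turns the cosine into a sine. *)
Lemma integral_cos n (c : R) (k : 'I_n -> int) :
  (\int[lebesgue_tuple n]_(t in cube n `[(- pi)%R, pi%R])
     (cos (c + \sum_(r < n) (k r)%:~R * tnth t r))%:E =
   (cos c * \prod_(r < n) (2 * pi *+ (k r == 0)))%:E)%E.
Proof.
elim: n c k => [|n IH] c k.
  rewrite big_ord0 mulr1.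
  under eq_integral do rewrite big_ord0 addr0.
  rewrite integral_cst //=; last exact: measurable_cube.
  by rewrite diracE mem_set ?mule1 // => -[].
rewrite (integral_cubeS (M := 1)) //.
- rewrite big_ord_recl mulrA -integral_cos1; apply: eq_integral => x _.
  rewrite -IH; apply: eq_integral => t _.
  rewrite big_ord_recl /= addrA; congr (cos (_ + _ + _))%:E.
  by apply: eq_bigr => i _; rewrite tnthS.
- rewrite /= lebesgue_measure_itv /=.
  by case: ifP => _; rewrite ?ltry // -EFinD ltry.
- apply: measurableT_comp; last exact: measurable_fun_affine.
  apply: continuous_measurable_fun; exact: continuous_cos.
- by move=> t; rewrite ler_norml cos_geN1 cos_le1.
Qed.

End fourier.

(** * The constant symbol 1 *)

Section symbol.

Context {R : realType}.
Local Notation C := R[i].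
Local Open Scope complex_scope.
Local Notation mT := (measurableTypeR R).

Lemma fourier_coef1 d (k : 'rV[int]_d) :
  fourier_coef (fun=> 1 : C) k = (k == 0)%:R.
Proof.
pose kN r : int := - k 0 r.
have freqE (t : d.-tuple mT) : - frequency k (row_of_tuple t) =
    \sum_(r < d) (kN r)%:~R * tnth t r.
  rewrite /frequency -sumrN; apply: eq_bigr => r _.
  by rewrite mxE /kN mulrNz mulNr.
have domE : [set t : d.-tuple mT | forall r, - pi <= row_of_tuple t 0 r <= pi] =
    cube (R := R) d `[(- pi)%R, pi%R].
  by apply/seteqP; split => t h r; have := h r; rewrite /= mxE in_itv.
have prodE : \prod_(r < d) (2 * pi *+ (kN r == 0)) =
    (2 * pi) ^+ d * (k == 0)%:R :> R.
  have [k0|/eqP k0] := eqVneq k 0.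
    rewrite mulr1 (eq_bigr (fun=> 2 * pi)) => [|r _]; last first.
      by rewrite /kN k0 mxE oppr0 eqxx mulr1n.
    by rewrite prodr_const card_ord.
  rewrite mulr0; have [r kr0] : exists r, k 0 r != 0.
    apply: contrapT => /forallNP h; apply: k0; apply/rowP => r.
    by rewrite mxE; apply/eqP; have /negP := h r; rewrite negbK.
  by rewrite (bigD1 r) //= /kN oppr_eq0 (negbTE kr0) mul0r.
have reE : Rintegral (lebesgue_tuple d) (cube (R := R) d `[(- pi)%R, pi%R])
    (fun t => complex.Re (1 * expi (- frequency k (row_of_tuple t)))) =
    (2 * pi) ^+ d * (k == 0)%:R.
  rewrite /Rintegral; under eq_integral do
    rewrite mul1r /= freqE -[in cos _](add0r (\sum_(_ < _) _)).
  by rewrite integral_cos cos0 mul1r prodE.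
have imE : Rintegral (lebesgue_tuple d) (cube (R := R) d `[(- pi)%R, pi%R])
    (fun t => complex.Im (1 * expi (- frequency k (row_of_tuple t)))) = 0.
  (* sin x = cos (- pi / 2 + x), and cos (- pi / 2) = 0. *)
  rewrite /Rintegral; under eq_integral do
    rewrite mul1r /= freqE -cosBpihalf addrC.
  by rewrite integral_cos cosN cos_pihalf mul0r.
rewrite /fourier_coef domE /cintegral reE imE -[_ +i* 0]/(_%:C) -rmorphM.
have pi0 := pi_gt0 R.
rewrite mulKf ?rmorph_nat //.
by rewrite expf_neq0 // gt_eqF // mulr_gt0.
Qed.

(** With W j the product of the sizes of the levels from j on, the quotients of l
    and l' by W j are equal for every j: both are 0 at j = 0, and one passes from
    j to j + 1 by appending the digit of level j.  At j = d they are l and l'. *)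
Lemma multi_index_inj d (N : d.-tuple nat) (l l' : 'I_(nu N)) :
  multi_index l =1 multi_index l' -> l = l'.
Proof.
move=> e; pose W j := (\prod_(s < d | (j <= s)%N) tnth N s)%N.
suff h j : (j <= d)%N -> (l %/ W j = l' %/ W j)%N.
  apply: val_inj; have := h d (leqnn d).
  by rewrite /W big_pred0 ?divn1 // => s; rewrite leqNgt ltn_ord.
elim: j => [_|j IH jd].
  by rewrite !divn_small ?[W 0%N]big_mkcond.
have WE : W j = (W j.+1 * tnth N (Ordinal jd))%N.
  rewrite /W (bigD1 (Ordinal jd)) //= mulnC; congr (_ * _)%N.
  by apply: eq_bigl => s; rewrite ltn_neqAle andbC -(inj_eq val_inj) /= eq_sym.
rewrite [LHS](divn_eq _ (tnth N (Ordinal jd))).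
rewrite [RHS](divn_eq _ (tnth N (Ordinal jd))).
rewrite -!divnMA -WE IH ?(ltnW jd) //; congr (_ + _)%N.
exact: (e (Ordinal jd)).
Qed.

Lemma toeplitz1 d (N : d.-tuple nat) : toeplitz N (fun=> 1 : C) = 1%:M.
Proof.
apply/matrixP => l l'; rewrite !mxE fourier_coef1; congr (_%:R).
congr nat_of_bool; apply/eqP/eqP => [/rowP h|->].
  apply: multi_index_inj => r; have /eqP := h r.
  by rewrite !mxE subr_eq0 eqz_nat => /eqP.
by apply/rowP => r; rewrite !mxE subrr.
Qed.

Lemma diag_sampling1 d (N : d.-tuple nat) : diag_sampling N (fun=> 1 : C) = 1%:M.
Proof.
by apply/matrixP => l l'; rewrite !mxE; case: eqP.
Qed.

Lemma trig_polynomial1 d : trig_polynomial (fun _ : 'rV[R]_d => 1 : C).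
Proof.
exists [:: (0, 1)]; apply/funext => th; rewrite big_seq1 mul1r /=.
rewrite /frequency big1 => [|r _]; last by rewrite mxE mul0r.
by rewrite /expi cos0 sin0.
Qed.

Lemma smooth_cst d (c : R) : smooth (fun _ : 'rV[R]_d => c).
Proof.
move=> s g; have [c' ->] : exists c', g = cst c'.
  rewrite {}/g; elim: s => [|i s [c' IH]]; first by exists c.
  exists 0; rewrite /= IH; apply/funext => x; exact: derive_cst.
by split=> [|i x]; [exact: cst_continuous|exact: derivable_cst].
Qed.

Lemma csmooth_cst d (c : C) : csmooth (fun _ : 'rV[R]_d => c).
Proof. by split; exact: smooth_cst. Qed.

Lemma admissible_symbol_domain (dd : nat -> nat) d (c : C) : dd @ \oo --> \oo ->
  admissible_symbol dd (symbol_domain d) (fun=> c).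
Proof.
move=> ddoo; pose A (i : 'I_(d + d)) : set mT :=
  if fintype.split i is inl _ then [set` `[0%R, 1%R]]
  else [set` `[(- pi)%R, pi%R]].
have domE : symbol_domain d =
    [set t : (d + d).-tuple mT | forall i, A i (tnth t i)].
  apply/seteqP; split => [t /= h i|t /= h r].
    rewrite /A; have := splitK i; case: (fintype.split i) => j <-.
      by have [] := h j; rewrite !mxE /= in_itv.
    by have [_] := h j; rewrite !mxE /= in_itv.
  rewrite !mxE; have := h (lshift d r); have := h (rshift d r).
  rewrite /A -[lshift d r]/(unsplit (inl r)) -[rshift d r]/(unsplit (inr r)).
  by rewrite !unsplitK /= !in_itv /=.
have mA i : measurable (A i).
  by rewrite /A; case: fintype.split => _; exact: measurable_itv.
have pi0 := pi_gt0 R.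
split => //; rewrite ?domE.
- exact: measurable_box.
- rewrite lebesgue_tuple_box //.
  have Afin i : (0 < lebesgue_measure (A i) < +oo)%E.
    rewrite /A; case: fintype.split => _;
      rewrite /= lebesgue_measure_itv /= lte_fin.
      by rewrite ltr01 -EFinD lte_fin subr0 ltr01 ltry.
    have piN : - pi < pi :> R by lra.
    by rewrite piN -EFinD ltry lte_fin andbT; lra.
  apply: (big_ind (fun x : \bar R => (0 < x < +oo)%E)) => //.
    by rewrite lte01 ltry.
  move=> x y /andP[x0 xoo] /andP[y0 yoo]; rewrite mule_gt0 //=.
  by rewrite lte_mul_pinfty ?(ltW x0) // ge0_fin_numE ?(ltW x0).
Qed.

Lemma mean_value_cst d (c : C) : mean_value (symbol_domain d) (fun=> c) = c.
Proof.
have [|_ mD /andP[D0 Doo] _] :=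
  @admissible_symbol_domain id d 0; first exact: cvg_id.
rewrite /mean_value /cintegral !Rintegral_cst //.
have D1 : fine (lebesgue_tuple (d + d) (symbol_domain (R := R) d)) != 0.
  by rewrite gt_eqF // fine_gt0 // D0.
case: c => a b /=; rewrite -[_%:C]/(_ +i* 0) /GRing.mul /= !mul0r subr0 addr0.
by congr (_ +i* _); rewrite mulrC mulfK.
Qed.

End symbol.

(** * The preconditioned matrices *)

Section precond.

Context {R : realType}.

Lemma rank_upper_right_block p1 p2 r1 r2 (B : 'M[R]_(p1, r2)) :
  (\rank (block_mx (0 : 'M[R]_(p1, r1)) B (0 : 'M[R]_(p2, r1)) 0) <= r2)%N.
Proof.
have -> : block_mx 0 B 0 0 =
    col_mx B (0 : 'M[R]_(p2, r2)) *m row_mx (0 : 'M[R]_(r2, r1)) 1%:M.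
  by rewrite mul_col_row !mulmx0 mulmx1 mul0mx.
exact: mulmx_max_rank.
Qed.

Lemma rank_castmx_sq n n' (e : n = n') (A : 'M[R]_n) :
  \rank (castmx (e, e) A) = \rank A.
Proof. by case: n' / e; rewrite castmx_id. Qed.

Lemma castmxB_sq n n' (e : n = n') (A B : 'M[R]_n) :
  castmx (e, e) A - castmx (e, e) B = castmx (e, e) (A - B).
Proof. by case: n' / e; rewrite !castmx_id. Qed.

Lemma rank_preconditioned_sub1 (xi eta1 eta2 rho T lambda : R) (q : R -> R)
    (a : R * R -> R) (m n1 n2 : nat) :
  Pmx xi eta1 eta2 rho T lambda a m n1 n2 \in unitmx ->
  (\rank (preconditioned xi eta1 eta2 rho T lambda q a m n1 n2 - 1%:M)%R
     <= n2 * n1)%N.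
Proof.
move=> uP; set P := Pmx _ _ _ _ _ _ _ _ _ _ in uP *.
rewrite /preconditioned -/P; set A := Amx _ _ _ _ _ _ _ _ _ _ _.
rewrite -(map_mx1 (real_complex R)) -map_mxB mxrank_map -(mulVmx uP) -mulmxBr.
apply: leq_trans (mxrankM_maxr _ _) _.
have -> : A - P = castmx (size_levels m n1 n2, size_levels m n1 n2)
    (block_mx 0 (- alpha xi T m *: (qvec T q m *t (1%:M : 'M[R]_(n2 * n1)))) 0 0).
  rewrite /A /P /Amx /Pmx castmxB_sq opp_block_mx add_block_mx.
  by rewrite !subrr oppr0 addr0.
rewrite rank_castmx_sq -[n in (_ <= n)%N]mul1n.
exact: rank_upper_right_block.
Qed.

End precond.

Theorem theorem5p2 (R : realType) (xi eta1 eta2 rho T lambda : R)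
    (q : R -> R) (a : R * R -> R) (m n1 n2 : nat -> nat)
    (hxi : 0 < xi < 1) (heta1 : 0 < eta1 < 1) (heta2 : 0 < eta2 < 1)
    (hrho : 0 < rho) (hT : 0 < T) (hlambda : 0 < lambda)
    (ha : {within `[0, 1] `*` `[0, 1], continuous a})
    (ha0 : forall x y, 0 < x < 1 -> 0 < y < 1 -> a (x, y) != 0)
    (hm0 : forall k, (0 < m k)%N)
    (hn10 : forall k, (0 < n1 k)%N)
    (hn20 : forall k, (0 < n2 k)%N)
    (hm : m @ \oo --> \oo) (hn1 : n1 @ \oo --> \oo) (hn2 : n2 @ \oo --> \oo)
    (hmono : {homo (fun k => (m k).+1 * n1 k * n2 k)%N : k l / (k <= l)%N})
    (hP : forall k,
      Pmx xi eta1 eta2 rho T lambda a (m k) (n1 k) (n2 k) \in unitmx) :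
  let X k :=
    preconditioned xi eta1 eta2 rho T lambda q a (m k) (n1 k) (n2 k) in
  [/\ GLT (fun k => levels (m k) (n1 k) (n2 k)) X (fun _ _ => 1),
      sv_distributed X (symbol_domain 3) (fun=> 1) &
      ev_distributed X (symbol_domain 3) (fun=> 1)].
Proof.
move=> X; pose N k := levels (m k) (n1 k) (n2 k).
have nuE k : nu (N k) = ((m k).+1 * (n2 k * n1 k))%N.
  by rewrite -[nu _](size_levels (m k) (n1 k) (n2 k)) -mulnDl addn1.
have rkX k : (\rank (X k - 1%:M)%R * (m k).+1 <= nu (N k))%N.
  rewrite [leqRHS]nuE mulnC leq_mul2l; apply/orP; right.
  exact: rank_preconditioned_sub1.
have nu0 k : (0 < nu (N k))%N by rewrite nuE !muln_gt0 hn10 hn20.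
have hm1 : (fun k => (m k).+1) @ \oo --> \oo.
  by apply/cvgnyPge => p; move/cvgnyPge: hm => /(_ p); apply: filterS => k /leqW.
have nuoo : (fun k => nu (N k)) @ \oo --> \oo.
  apply/cvgnyPge => p; move/cvgnyPge: hm1 => /(_ p).
  apply: filterS => k /leq_trans; apply.
  by rewrite nuE leq_pmulr // muln_gt0 hn10 hn20.
split.
(* The relative rank of X k - 1 is at most 1 / (m k + 1), hence at most
   1 / (p + 1) once m k >= p, that is, from k0 p on. *)
- have /choice[k0 hk0] : forall p, exists p0, forall k,
      (p0 <= k)%N -> (p.+1 <= (m k).+1)%N.
    move=> p; move/cvgnyPge: hm1 => /(_ p.+1) [p0 _ hp0].
    by exists p0 => k; exact: hp0.
  split.
  + by case=> [[|[|[|//]]] i3]; [exact: hm1|exact: hn2|exact: hn1].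
  + by split; exact: measurable_cst.
  exists (fun=> 1%N), (fun _ _ _ => 1), (fun _ _ _ => 1); split.
  + by move=> p j; split; [exact: csmooth_cst|exact: trig_polynomial1].
  + move=> e e0; rewrite [X in X @ _](_ : _ = fun=> 0%E); first exact: cvg_cst.
    apply/funext => p; rewrite (_ : _ `&` _ = set0) ?measure0 //.
    apply/seteqP; split => // z [_] /=.
    rewrite /on_symbol_domain big_ord_recl big_ord0 addr0 mulr1 subrr.
    by rewrite /cmodulus normr0 /= leNgt e0.
  exists harmonic, (fun=> 0), k0; split; [exact: cvg_harmonic|exact: cvg_cst|].
  move=> p k pk; exists (X k - 1%:M), 0; split.
  + rewrite big_ord_recl big_ord0 diag_sampling1 toeplitz1 mulmx1 !addr0.
    by rewrite addrC subrK.
  + rewrite /harmonic /= ler_pdivlMl ?ltr0n // -natrM ler_nat.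
    apply: leq_trans (rkX k); rewrite mulnC leq_mul2l; apply/orP; right.
    exact: hk0.
  + by rewrite spectral_norm0.
- split=> [|F cF cK]; first exact: admissible_symbol_domain.
  have [B B0 FB] := bounded_compact_support cF cK.
  have -> : mean_value (symbol_domain 3) (fun=> F (cmodulus (1 : R[i]))) = F 1.
    by rewrite mean_value_cst /cmodulus normr1.
  apply: (cvg_mean_few_outliers (K := 2) FB hm1 nu0) => k.
    exact: size_singular_values.
  apply: leq_trans (leq_mul (count_singular_values_neq1 (X k)) (leqnn _)) _.
  by rewrite addnn -mul2n -mulnA leq_mul2l rkX.
- split=> [|F cF cK]; first exact: admissible_symbol_domain.
  have [B B0 FB] := bounded_compact_support cF cK.
  rewrite mean_value_cst.
  apply: (cvg_mean_few_outliers (K := 1) FB hm1 nu0) => k.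
    exact: size_eigenvalues.
  apply: leq_trans (leq_mul (count_eigenvalues_neq (X k) 1) (leqnn _)) _.
  by rewrite mul1n rkX.
Qed.
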